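(* Let $N<\infty$ and let $X=(X_\nu)_{\nu=0}^N$ be an $\mathbb F$-adapted real-valued reward sequence with $\mathrm E[\max_{0\le\nu\le N}|X_\nu|]<\infty$. Then for every $m\in\{1,2,\dots\}$ and every $\sigma\in\mathcal T$, $$V^{[m]}_\sigma=\operatorname*{ess\,sup}_{\vec\tau\in\mathcal T^{[m]}_\sigma}\mathrm E\big[X_{\vec\tau}\mid\mathcal F_\sigma\big]\qquad\text{a.s.},$$ and the vector $\vec\tau^{\,*}=(\tau^*_m,\dots,\tau^*_1)$ is admissible, i.e. $\vec\tau^{\,*}\in\mathcal T^{[m]}_\sigma$, and optimal: $V^{[m]}_\sigma=\mathrm E[X_{\vec\tau^{\,*}}\mid\mathcal F_\sigma]$ a.s. Here $\mathcal T$, $\mathcal T^{[m]}_\sigma$, $X_{\vec\tau}$, $V^{[m]}$ and $\vec\tau^{\,*}$ are as defined in the context.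
   Context: $(\Omega,\mathcal F,\mathrm P)$ is a probability space with filtration $\mathbb F=(\mathcal F_\nu)_{\nu=0}^N$, $N$ a finite nonnegative integer. A cemetery (non-exercise) time $\partial:=+\infty$ is added, with $\mathcal F_\partial:=\mathcal F_N$ and $X_\partial:=0$. Put $\mathbb T:=\{0,\dots,N\}\cup\{\partial\}$, ordered so that $\nu<\partial$ for all $\nu\le N$, with the successor convention $N+1:=\partial$ and $\partial+1:=\partial$. $\mathcal T$ is the set of $\mathbb F$-stopping times with values in $\mathbb T$; for $\sigma\in\mathcal T$, $\mathcal T^\sigma$ is the set of $\tau\in\mathcal T$ with $\tau\ge\sigma$. Admissible vectors: $\mathcal T^{[m]}_\sigma$ is the set of vectors $\vec\tau=(\tau_m,\tau_{m-1},\dots,\tau_1)$ of elements of $\mathcal T^\sigma$ such that, pathwise (for each $\omega$), there is $\ell=\ell(\omega)\in\{0,\dots,m\}$ for which the finite coordinates are exactly $\tau_m,\tau_{m-1},\dots,\tau_{m-\ell+1}$, these satisfy $\sigma\le\tau_m<\tau_{m-1}<\dots<\tau_{m-\ell+1}\le N$ if $\ell\ge1$, and the remaining coordinates $\tau_{m-\ell},\dots,\tau_1$ all equal $\partial$. Set $X_{\vec\tau}:=\sum_{i=1}^mX_{\tau_i}$. Snell envelope: for an adapted integrable process $(Y_\nu)_{\nu=0}^N$ with $Y_\partial:=0$, its Snell envelope is $(U_\nu)$ defined by $U_\partial:=0$ and $U_\nu:=\max\{Y_\nu,\mathrm E[U_{\nu+1}\mid\mathcal F_\nu]\}$ for $\nu=N,N-1,\dots,0$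 (with $U_{N+1}:=U_\partial=0$). Nested construction: $V^{[0]}\equiv0$ and, for $i=1,\dots,m$, $X^{[i]}_\nu:=X_\nu+\mathrm E[V^{[i-1]}_{\nu+1}\mid\mathcal F_\nu]$ for $0\le\nu\le N$, $X^{[i]}_\partial:=0$, and $V^{[i]}$ is the Snell envelope of $X^{[i]}$ (with $V^{[i]}_\partial:=0$). Recursive stopping times: for fixed $\sigma\in\mathcal T$ and $m$, $\tau^*_m:=\min\{\nu\ge\sigma:V^{[m]}_\nu=X^{[m]}_\nu\}$ and $\tau^*_i:=\min\{\nu\ge\tau^*_{i+1}+1:V^{[i]}_\nu=X^{[i]}_\nu\}$ for $i=m-1,\dots,1$, with $\min\emptyset:=\partial$. *)

(* Defs.v *)
From HB Require Import structures.
From mathcomp Require Import all_boot all_order all_algebra.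
From mathcomp Require Import all_classical all_reals all_analysis.
From mathcomp Require Import measurable_realfun.

Set Implicit Arguments.
Unset Strict Implicit.
Unset Printing Implicit Defensive.

Import Order.TTheory GRing.Theory Num.Theory.
Import numFieldNormedType.Exports.

Local Open Scope classical_set_scope.
Local Open Scope ring_scope.

Section Times.
Variable N : nat.

(* The ordered set {0, ..., N} U {oo}: the ordinal N+1 is the cemetery, in
   accordance with the convention N + 1 := oo; in particular the order of the
   ordinals is the order of the times.  Genuine dates are of type 'I_N.+1. *)
Definition time := 'I_N.+2.

Definition cemetery : time := ord_max.

Definition of_date (n : 'I_N.+1) : time := lift ord_max n.

(* [lift ord0 n] is the ordinal n + 1 of 'I_N.+2. *)
Definition next_date (n : 'I_N.+1) : time := lift ord0 n.

Definition succ_time (t : time) : time :=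
  if unlift ord_max t is Some n then next_date n else cemetery.

Lemma of_dateE (n : 'I_N.+1) : of_date n = n :> nat.
Proof. by rewrite /of_date lift_max. Qed.

Lemma next_dateE (n : 'I_N.+1) : next_date n = n.+1 :> nat.
Proof. by []. Qed.

Lemma succ_timeE (t : time) : succ_time t = minn t.+1 N.+1 :> nat.
Proof.
rewrite /succ_time; case: unliftP => [n ->|->].
  by rewrite lift_max next_dateE; apply/esym/minn_idPl; exact: ltn_ord.
by apply/esym/minn_idPr; exact: leqnSn.
Qed.

(* Extension of a family indexed by the dates by a value at the cemetery. *)
Definition extend_time (A : Type) (a : A) (f : 'I_N.+1 -> A) (t : time) : A :=
  if unlift ord_max t is Some n then f n else a.

End Times.

Arguments cemetery {N}.

Section ConditionalExpectation.
Context (d : measure_display) (T : measurableType d) (R : realType).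
Variable P : probability T R.

Definition is_condexp (G : set (set T)) (Y Z : T -> R) : Prop :=
  [/\ measurable_fun setT (Z : g_sigma_algebraType G -> R),
      P.-integrable setT (EFin \o Z)
    & forall A, G A ->
        (\int[P]_(w in A) (Z w)%:E = \int[P]_(w in A) (Y w)%:E)%E].

(* An everywhere defined, real-valued, G-measurable version of E[Y | G],
   arbitrarily chosen; only meaningful when Y is integrable and G is a
   sub-sigma-algebra (the junk value is 0 when there is no version). *)
Definition condexp (G : set (set T)) (Y : T -> R) : T -> R :=
  xget (cst 0) [set Z | is_condexp G Y Z].

(* Z is the essential supremum of the family A of random variables, i.e. its
   least upper bound with respect to almost sure inequality. *)
Definition is_family_ess_sup (A : set (T -> \bar R)) (Z : T -> \bar R) : Prop :=
  [/\ measurable_fun setT Z,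
      forall Y, A Y -> {ae P, forall w, (Y w <= Z w)%E}
    & forall Z', measurable_fun setT Z' ->
        (forall Y, A Y -> {ae P, forall w, (Y w <= Z' w)%E}) ->
        {ae P, forall w, (Z w <= Z' w)%E}].

End ConditionalExpectation.

Section MultipleStopping.
Context (d : measure_display) (T : measurableType d) (R : realType).
Variable P : probability T R.
Variable N : nat.

Definition is_filtration (F : 'I_N.+1 -> set (set T)) : Prop :=
  [/\ forall n, sigma_algebra setT (F n),
      forall n, F n `<=` measurable
    & forall n p : 'I_N.+1, (n <= p)%N -> F n `<=` F p].

Variable F : 'I_N.+1 -> set (set T).

Definition adapted (Y : 'I_N.+1 -> T -> R) : Prop :=
  forall n, measurable_fun setT (Y n : g_sigma_algebraType (F n) -> R).

Definition sigma_at : time N -> set (set T) := extend_time (F ord_max) F.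

Definition process_at (Y : 'I_N.+1 -> T -> R) : time N -> T -> R :=
  extend_time (cst 0) Y.

Definition stopped (Y : time N -> T -> R) (tau : T -> time N) : T -> R :=
  fun w => Y (tau w) w.

Definition stopping_time (tau : T -> time N) : Prop :=
  forall t : time N, sigma_at t [set w | (tau w <= t)%N].

(* The sigma-algebra of the past of a stopping time. The instance t = oo says
   that the event belongs to F_N. *)
Definition stopped_sigma (tau : T -> time N) : set (set T) :=
  [set A | forall t : time N, sigma_at t (A `&` [set w | (tau w <= t)%N])].

(* Coordinate j (counted from 0) of a vector of size m is the component
   tau_(m - j) of (tau_m, ..., tau_1), and l is the number of finite
   components. *)
Definition admissible (sigma : T -> time N) (m : nat)
    (tau : 'I_m -> T -> time N) : Prop :=
  (forall j, stopping_time (tau j) /\ forall w, (sigma w <= tau j w)%N) /\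
  forall w, exists l : nat,
    [/\ (l <= m)%N,
        forall j : 'I_m, (j < l)%N = (tau j w != cemetery),
        forall j : 'I_m, (j < l)%N -> (sigma w <= tau j w)%N
      & forall j k : 'I_m, (j < k)%N -> (k < l)%N -> (tau j w < tau k w)%N].

Definition total_reward (X : 'I_N.+1 -> T -> R) (m : nat)
    (tau : 'I_m -> T -> time N) : T -> R :=
  fun w => \sum_(j < m) stopped (process_at X) (tau j) w.

(* Backward induction; k is the number of steps left before the cemetery, so
   that the values are those at time N + 1 - k. *)
Fixpoint snell_steps (Y : 'I_N.+1 -> T -> R) (k : nat) : T -> R :=
  if k is k'.+1 then
    let n : 'I_N.+1 := inord (N - k') in
    fun w => Num.max (Y n w) (condexp P (F n) (snell_steps Y k') w)
  else cst 0.

Definition snell (Y : 'I_N.+1 -> T -> R) (t : time N) : T -> R :=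
  snell_steps Y (N.+1 - t).

Lemma snell_cemetery (Y : 'I_N.+1 -> T -> R) : snell Y cemetery = cst 0.
Proof. by rewrite /snell subnn. Qed.

Lemma snellE (Y : 'I_N.+1 -> T -> R) (n : 'I_N.+1) (w : T) :
  snell Y (of_date n) w =
  Num.max (Y n w) (condexp P (F n) (snell Y (next_date n)) w).
Proof.
have nN : (n <= N)%N by rewrite -ltnS.
by rewrite /snell of_dateE next_dateE subSn//= subKn// inord_val subSS.
Qed.

(* X + E[V_(. + 1) | F_.]; applied to V = V^[i - 1] it gives X^[i]. *)
Definition nested_reward (X : 'I_N.+1 -> T -> R) (V : time N -> T -> R)
    (n : 'I_N.+1) : T -> R :=
  fun w => X n w + condexp P (F n) (V (next_date n)) w.

Fixpoint V_ (X : 'I_N.+1 -> T -> R) (i : nat) : time N -> T -> R :=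
  if i is i'.+1 then snell (nested_reward X (V_ X i')) else fun=> cst 0.

(* X^[i], meaningful for i >= 1. *)
Definition X_ (X : 'I_N.+1 -> T -> R) (i : nat) : 'I_N.+1 -> T -> R :=
  nested_reward X (V_ X i.-1).

Definition first_contact (V : time N -> T -> R) (Y : 'I_N.+1 -> T -> R)
    (s : time N) (w : T) : time N :=
  \big[Order.min/cemetery]_(n : 'I_N.+1 |
      (s <= of_date n)%N && (V (of_date n) w == Y n w)) of_date n.

(* As in [admissible], index j stands for the component tau*_(m - j). *)
Fixpoint opt_time (X : 'I_N.+1 -> T -> R) (m : nat) (sigma : T -> time N)
    (j : nat) (w : T) : time N :=
  first_contact (V_ X (m - j)) (X_ X (m - j))
    (if j is j'.+1 then succ_time (opt_time X m sigma j' w) else sigma w) w.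

Definition opt_times (X : 'I_N.+1 -> T -> R) (m : nat) (sigma : T -> time N) :
    'I_m -> T -> time N :=
  fun j => opt_time X m sigma j.

End MultipleStopping.

Arguments opt_times {d T R} P {N} F X m sigma.

(* Main.v *)
(** Everything is compared through integrals over events of the past of sigma;
    two random variables measurable with respect to that past are then ordered
    almost surely.  For the Snell envelope U of Y, the difference
    U_tau - U_sigma is the sum over n of U_(n+1) - U_n on {sigma <= n < tau}, an
    event of F_n.  So its integrals are nonpositive, and they vanish if tau is
    the first contact time of U and Y after sigma.  With Y = X^[i], the integral
    of X^[i]_tau is that of X_tau plus that of V^[i-1] at tau + 1, and the tail
    of an admissible vector is an admissible vector from time tau_m + 1 on:
    induction on m. *)

From HB Require Import structures.
Require Import Defs.
From mathcomp Require Import all_boot all_order all_algebra.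
From mathcomp Require Import all_classical all_reals all_analysis.
From mathcomp Require Import measurable_realfun.

Set Implicit Arguments.
Unset Strict Implicit.
Unset Printing Implicit Defensive.

Import Order.TTheory GRing.Theory Num.Theory.
Import numFieldNormedType.Exports.

Local Open Scope classical_set_scope.
Local Open Scope ring_scope.

(** * Conditional expectations and almost sure comparison *)

Section sub_sigma_algebra.
Context (d : measure_display) (T : measurableType d) (R : realType).
Variables (P : probability T R) (G : set (set T)).
Hypotheses (sG : sigma_algebra setT G) (subG : G `<=` measurable).

Lemma sub_sigma_algebraE (A : set T) :
  G A = measurable (A : set (g_sigma_algebraType G)).
Proof. by rewrite /measurable/= sigma_algebra_id. Qed.

Lemma sub_sigma_algebraT : G setT.
Proof. by rewrite sub_sigma_algebraE; exact: measurableT. Qed.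

Lemma sub_sigma_algebraI (A B : set T) : G A -> G B -> G (A `&` B).
Proof. rewrite !sub_sigma_algebraE; exact: measurableI. Qed.

Lemma sub_sigma_algebraD (A B : set T) : G A -> G B -> G (A `\` B).
Proof. rewrite !sub_sigma_algebraE; exact: measurableD. Qed.

Lemma sub_sigma_algebra_fin_bigcup (I : finType) (D : set I) (A : I -> set T) :
  (forall i, D i -> G (A i)) -> G (\bigcup_(i in D) A i).
Proof.
move=> GA; rewrite sub_sigma_algebraE.
apply: fin_bigcup_measurable => [|i Di]; first exact: finite_finset.
by rewrite -sub_sigma_algebraE; exact: GA.
Qed.

Lemma sub_measurable_fun (Z : T -> R) :
  measurable_fun setT (Z : g_sigma_algebraType G -> R) ->
  measurable_fun setT Z.
Proof.
move=> mZ _ B mB; apply: subG; rewrite sub_sigma_algebraE.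
exact: (mZ measurableT).
Qed.

(** Pushing a measure forward along this identity restricts it to [G]. *)
Let incl : T -> g_sigma_algebraType G := id.

Let measurable_incl : measurable_fun setT incl.
Proof. by move=> _ A mA; rewrite setTI; apply: subG; rewrite sub_sigma_algebraE. Qed.

(** A version is the Radon-Nikodym derivative of the charge with density [Y] with respect to [P],
    both restricted to [G]. *)
Lemma is_condexp_ex (Y : T -> R) :
  P.-integrable setT (EFin \o Y) -> exists Z, is_condexp P G Y Z.
Proof.
move=> iY.
pose phi : {mfun T >-> g_sigma_algebraType G} := HB.pack incl
  (isMeasurableFun.Build _ _ _ _ incl measurable_incl).
pose mu : {sigma_finite_measure set (g_sigma_algebraType G) -> \bar R} :=
  distribution P phi.
(* The charge structure of a pushforward depends on a proof that the map is
   measurable: nu_ is a function of this proof. *)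
pose nu_ : {charge set (g_sigma_algebraType G) -> \bar R} :=
  pushforward (induced_charge iY) phi.
pose nu := nu_ (measurable_funP phi).
have numu : nu `<< mu.
  apply: dominates_pushforward; first exact: measurable_funP.
  apply/null_content_dominatesP => A mA PA.
  by apply: null_set_integral => //;
    exact/measurable_funTS/(measurable_int P iY).
(* The derivative is finite everywhere, so [fine] only changes its codomain. *)
exists (fine \o Radon_Nikodym nu mu).
have iRN := Radon_Nikodym_integrable numu.
have fRN : EFin \o (fine \o Radon_Nikodym nu mu) = Radon_Nikodym nu mu.
  by apply/funext => x /=; rewrite fineK// Radon_Nikodym_fin_num.
have mRN : measurable_fun setT (Radon_Nikodym nu mu) by exact: measurable_int iRN.
have iRNP : P.-integrable setT (Radon_Nikodym nu mu).
  apply/integrableP; split.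
    move=> _ B mB; apply: subG; rewrite sub_sigma_algebraE.
    exact: mRN.
  (* Change of variables along the identity: the integral of the absolute value under [mu] is the
     one under [P]. *)
  move/integrableP : iRN => [_].
  by rewrite ge0_integral_pushforward//; exact: measurableT_comp.
split.
- exact: measurableT_comp.
- by rewrite fRN.
move=> A; rewrite sub_sigma_algebraE => mA.
have -> : (\int[P]_(w in A) (Y w)%:E = nu A)%E by [].
rewrite (Radon_Nikodym_integral numu mA) integral_pushforward//=; last first.
  apply: (integrableS measurableT) => //.
  by apply: subG; rewrite sub_sigma_algebraE.
by apply: eq_integral => x _; rewrite /= fineK// Radon_Nikodym_fin_num.
Qed.

Lemma condexpP (Y : T -> R) :
  P.-integrable setT (EFin \o Y) -> is_condexp P G Y (condexp P G Y).
Proof. by move=> /is_condexp_ex[Z ZY]; exact: (xgetPex (cst 0) (ex_intro _ Z ZY)). Qed.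

Lemma Rintegral_condexp (Y : T -> R) (A : set T) :
  P.-integrable setT (EFin \o Y) -> G A ->
  (\int[P]_(w in A) condexp P G Y w = \int[P]_(w in A) Y w)%R.
Proof. by move=> /condexpP[_ _ + GA] => /(_ _ GA) e; rewrite /Rintegral e. Qed.

(** The event where Z < Y lies in [G], so the hypothesis can be tested on it: Y - Z is positive
    there and has a nonpositive integral, which forces the event to be null. *)
Lemma le_ae_of_le_Rintegral (Y Z : T -> R) :
  measurable_fun setT (Y : g_sigma_algebraType G -> R) ->
  measurable_fun setT (Z : g_sigma_algebraType G -> R) ->
  P.-integrable setT (EFin \o Y) -> P.-integrable setT (EFin \o Z) ->
  (forall A, G A ->
    (\int[P]_(w in A) Y w)%R <= (\int[P]_(w in A) Z w)%R) ->
  {ae P, forall w, Y w <= Z w}.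
Proof.
move=> mY mZ iY iZ YZ.
pose A := [set w | Z w < Y w].
have GA : G A.
  rewrite sub_sigma_algebraE.
  have := measurable_fun_ltr mZ mY; move=> /(_ measurableT [set true] I).
  by rewrite setTI.
have mA := subG GA.
have iYA : P.-integrable A (EFin \o Y) by exact: (integrableS measurableT).
have iZA : P.-integrable A (EFin \o Z) by exact: (integrableS measurableT).
pose D : T -> R := Y \- Z.
have iD : P.-integrable A (EFin \o D).
  exact: (integrableB mA iYA iZA).
have int0 : (\int[P]_(w in A) `|(EFin \o D) w| = 0)%E.
  rewrite (eq_integral (EFin \o D)); last first.
    by move=> w /[!inE] Aw /=; rewrite ger0_norm// subr_ge0 ltW.
  rewrite -[LHS]fineK; last exact: integrable_fin_num.
  have -> : fine (\int[P]_(w in A) (EFin \o D) w)%E =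
      (\int[P]_(w in A) (Y w - Z w))%R by [].
  rewrite RintegralB//; congr EFin; apply/eqP; rewrite eq_le subr_le0 YZ//=.
  rewrite subr_ge0; apply: le_Rintegral => // w Aw.
  exact: ltW.
have := (ae_eq_integral_abs P mA (measurable_int P iD)).1 int0.
apply: filterS => w /= Aw; rewrite leNgt; apply/negP => YZw.
have := Aw YZw => -[/eqP]; rewrite subr_eq0 => /eqP e.
by rewrite e ltxx in YZw.
Qed.

End sub_sigma_algebra.

(** * The ordered set of times *)

Section times.
Variable N : nat.

Lemma extend_time_date (A : Type) (a : A) (f : 'I_N.+1 -> A) (n : 'I_N.+1) :
  extend_time a f (of_date n) = f n.
Proof. by rewrite /extend_time /of_date liftK. Qed.

Lemma extend_time_cemetery (A : Type) (a : A) (f : 'I_N.+1 -> A) :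
  extend_time a f cemetery = a.
Proof. by rewrite /extend_time unlift_none. Qed.

Lemma le_cemetery (t : time N) : (t <= @cemetery N)%N.
Proof. by rewrite /= -ltnS. Qed.

(** Destructing a time through this view exposes the forms on which [extend_time] and [succ_time]
    can be rewritten. *)
Variant time_spec : time N -> Type :=
  | TimeDate (n : 'I_N.+1) : time_spec (of_date n)
  | TimeCemetery : time_spec cemetery.

Lemma timeP (t : time N) : time_spec t.
Proof. by case: (unliftP ord_max t) => [n|] ->; constructor. Qed.

Lemma of_date_lt_cemetery (n : 'I_N.+1) : (of_date n < @cemetery N)%N.
Proof. by rewrite of_dateE /=. Qed.

Lemma succ_time_date (n : 'I_N.+1) : succ_time (of_date n) = next_date n.
Proof. by rewrite /succ_time /of_date liftK. Qed.

Lemma succ_time_cemetery : succ_time (@cemetery N) = cemetery.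
Proof. by rewrite /succ_time unlift_none. Qed.

Lemma le_succ_time (t : time N) : (t <= succ_time t)%N.
Proof. by rewrite succ_timeE leq_min leqnSn le_cemetery. Qed.

End times.

(** * Stopping times and their pasts *)

Section stopping_times.
Context (d : measure_display) (T : measurableType d) (R : realType).
Variables (P : probability T R) (N : nat) (F : 'I_N.+1 -> set (set T)).
Hypothesis hF : is_filtration F.

Implicit Types (t s : time N) (A B : set T) (sigma tau : T -> time N).

Let G := sigma_at F.

Lemma sigma_at_sigma_algebra t : sigma_algebra setT (G t).
Proof.
case: hF => sF _ _; rewrite /G /sigma_at.
by case: (timeP t) => [n|]; rewrite ?extend_time_date ?extend_time_cemetery.
Qed.

Lemma sigma_at_measurable t : G t `<=` measurable.
Proof.
case: hF => _ mF _; rewrite /G /sigma_at.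
by case: (timeP t) => [n|]; rewrite ?extend_time_date ?extend_time_cemetery.
Qed.

Lemma sigma_at_le s t : (s <= t)%N -> G s `<=` G t.
Proof.
case: hF => _ _ leF; rewrite /G /sigma_at.
case: (timeP s) (timeP t) => [n|] [p|]; rewrite ?extend_time_date ?extend_time_cemetery //.
- by rewrite !of_dateE => /leF.
- by move=> _; apply: leF; rewrite /= -ltnS.
- by rewrite leqNgt of_date_lt_cemetery.
- by move=> _.
Qed.

(** There are finitely many times, so the event is a finite union of events known at times s < t. *)
Lemma stopped_sigma_lt tau A t : stopped_sigma F tau A ->
  G t (A `&` [set w | (tau w < t)%N]).
Proof.
move=> sA.
have -> : A `&` [set w | (tau w < t)%N] =
    \bigcup_(s in [set s : time N | (s < t)%N]) (A `&` [set w | (tau w <= s)%N]).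
  apply/seteqP; split=> [w /= [Aw tw]|w /= [s /= st [Aw ts]]].
    by exists (tau w) => //=; split.
  by split => //; exact: leq_ltn_trans ts st.
apply: sub_sigma_algebra_fin_bigcup => [|s /= st]; first exact: sigma_at_sigma_algebra.
exact: (sigma_at_le (ltnW st) (sA s)).
Qed.

Lemma stopped_sigma_eq tau A t : stopped_sigma F tau A ->
  G t (A `&` [set w | tau w = t]).
Proof.
move=> sA.
have -> : A `&` [set w | tau w = t] =
    (A `&` [set w | (tau w <= t)%N]) `\` (A `&` [set w | (tau w < t)%N]).
  apply/seteqP; split=> [w /= [Aw tw]|w /= [[Aw tw] n]].
    by rewrite tw; split => // -[_]; rewrite ltnn.
  split => //; apply/val_inj/eqP => /=; rewrite eqn_leq tw/= leqNgt.
  by apply/negP => ?; apply: n.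
apply: sub_sigma_algebraD; first exact: sigma_at_sigma_algebra.
  exact: sA.
exact: stopped_sigma_lt.
Qed.

(** Together with [stopped_sigma_eq], this reduces membership in the past of [tau] to the level sets
    of [tau], on which a stopped process is a process at a fixed time. *)
Lemma stopped_sigma_of_eq tau A :
  (forall t, G t (A `&` [set w | tau w = t])) -> stopped_sigma F tau A.
Proof.
move=> sA t.
have -> : A `&` [set w | (tau w <= t)%N] =
    \bigcup_(s in [set s : time N | (s <= t)%N]) (A `&` [set w | tau w = s]).
  apply/seteqP; split=> [w /= [Aw tw]|w /= [s /= st [Aw ts]]].
    by exists (tau w) => //=; split.
  by split => //; rewrite ts.
apply: sub_sigma_algebra_fin_bigcup => [|s /= st]; first exact: sigma_at_sigma_algebra.
exact: (sigma_at_le st (sA s)).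
Qed.

Lemma stopping_timeT tau : stopping_time F tau <-> stopped_sigma F tau setT.
Proof. by split=> h t; have := h t; rewrite setTI. Qed.

Lemma stopping_time_of_eq tau :
  (forall t, G t [set w | tau w = t]) -> stopping_time F tau.
Proof.
move=> h; apply/stopping_timeT; apply: stopped_sigma_of_eq => t.
by rewrite setTI; exact: h.
Qed.

Lemma stopping_time_eq tau t : stopping_time F tau -> G t [set w | tau w = t].
Proof. by move=> /stopping_timeT/stopped_sigma_eq => /(_ t); rewrite setTI. Qed.

Lemma stopped_sigma_sigma_algebra tau : stopping_time F tau ->
  sigma_algebra setT (stopped_sigma F tau).
Proof.
move=> stau; split.
- move=> t; rewrite set0I.
  by have [] := sigma_at_sigma_algebra t.
- move=> A sA t.
  (* The complement of [A] is taken inside the event tau <= t, which is known at time t because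
     [tau] is a stopping time. *)
  have -> : (setT `\` A) `&` [set w | (tau w <= t)%N] =
      [set w | (tau w <= t)%N] `\` (A `&` [set w | (tau w <= t)%N]).
    by rewrite setTD setDE setCI setIUr setICr setU0 setIC.
  by apply: sub_sigma_algebraD; [exact: sigma_at_sigma_algebra|exact: stau|exact: sA].
- move=> A sA t; rewrite setI_bigcupl.
  by have [_ _] := sigma_at_sigma_algebra t; apply => i; exact: sA.
Qed.

Lemma stopped_sigma_measurable tau : stopped_sigma F tau `<=` measurable.
Proof.
(* At the cemetery the condition tau <= t holds everywhere, so the trace of [A] is [A] itself. *)
move=> A /(_ cemetery) /sigma_at_measurable.
rewrite (_ : A `&` _ = A)//; apply/setIidPl => w _ /=; exact: le_cemetery.
Qed.

(** This lets one fixed event of the past of [sigma] serve as a test event at all the later stopping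
    times of the induction. *)
Lemma stopped_sigma_mono sigma tau : stopping_time F tau ->
  (forall w, (sigma w <= tau w)%N) ->
  stopped_sigma F sigma `<=` stopped_sigma F tau.
Proof.
move=> stau st A sA t.
have -> : A `&` [set w | (tau w <= t)%N] =
    (A `&` [set w | (sigma w <= t)%N]) `&` [set w | (tau w <= t)%N].
  apply/seteqP; split=> w /=; last by tauto.
  by move=> [Aw tw]; do !split => //; exact: leq_trans (st w) tw.
by apply: sub_sigma_algebraI; [exact: sigma_at_sigma_algebra|exact: sA|exact: stau].
Qed.

(** The level sets are unions because the cemetery has two predecessors, the last date and itself;
    each predecessor s of t satisfies s <= t. *)
Lemma stopping_time_succ tau : stopping_time F tau ->
  stopping_time F (fun w => succ_time (tau w)).
Proof.
move=> stau; apply: stopping_time_of_eq => t.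
have -> : [set w | succ_time (tau w) = t] =
    \bigcup_(s in [set s | succ_time s = t]) [set w | tau w = s].
  apply/seteqP; split=> [w /= tw|w /= [s /= st tw]]; first by exists (tau w).
  by rewrite tw.
apply: sub_sigma_algebra_fin_bigcup => [|s /= st]; first exact: sigma_at_sigma_algebra.
apply: (@sigma_at_le s); last exact: stopping_time_eq.
by rewrite -st le_succ_time.
Qed.

Lemma measurable_stopped (Y : time N -> T -> R) tau :
  stopping_time F tau ->
  (forall t, measurable_fun setT (Y t : g_sigma_algebraType (G t) -> R)) ->
  measurable_fun setT
    (stopped Y tau : g_sigma_algebraType (stopped_sigma F tau) -> R).
Proof.
move=> stau mY _ B mB; rewrite setTI.
rewrite -(sub_sigma_algebraE (stopped_sigma_sigma_algebra stau)).
apply: stopped_sigma_of_eq => t.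
have -> : stopped Y tau @^-1` B `&` [set w | tau w = t] =
    Y t @^-1` B `&` [set w | tau w = t].
  by apply/seteqP; split=> w /=; rewrite /stopped => -[+ tw]; rewrite tw.
have sGt := sigma_at_sigma_algebra t.
apply: sub_sigma_algebraI => //; last exact: stopping_time_eq.
by rewrite sub_sigma_algebraE// -[X in measurable X]setTI; exact: mY.
Qed.

End stopping_times.

(** * Integrals of stopped processes *)

Section integrals.
Context (d : measure_display) (T : measurableType d) (R : realType).
Variable mu : {measure set T -> \bar R}.

Lemma integrable_fin_sum (I : finType) (f : I -> T -> R) :
  (forall i, mu.-integrable setT (EFin \o f i)) ->
  mu.-integrable setT (EFin \o (fun w => \sum_i f i w)).
Proof.
move=> fi; rewrite (_ : _ \o _ = fun w => (\sum_i (f i w)%:E)%E).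
  by apply: integrable_sum => // i _; exact: fi.
by apply/funext => w /=; rewrite sumEFin.
Qed.

Lemma Rintegral_fin_sum (I : finType) (f : I -> T -> R) (A : set T) :
  measurable A -> (forall i, mu.-integrable setT (EFin \o f i)) ->
  (\int[mu]_(w in A) (\sum_i f i w) = \sum_i \int[mu]_(w in A) f i w)%R.
Proof.
move=> mA fi.
have fiA i : mu.-integrable A (EFin \o f i) by exact: (integrableS measurableT).
elim: (index_enum I) => [|i s IH].
  rewrite big_nil; under eq_Rintegral do rewrite big_nil.
  by rewrite Rintegral_cst// mul0r.
rewrite big_cons -IH; under eq_Rintegral do rewrite big_cons.
rewrite RintegralD//.
rewrite (_ : _ \o _ = fun w => (\sum_(j <- s) (f j w)%:E)%E).
  by apply: integrable_sum => // j _; exact: fiA.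
by apply/funext => w /=; rewrite sumEFin.
Qed.

Lemma integrable_restrict (f : T -> R) (B : set T) : measurable B ->
  mu.-integrable setT (EFin \o f) -> mu.-integrable setT (EFin \o (f \_ B)).
Proof.
move=> mB fi; rewrite -restrict_EFin; apply: (integrable_mkcond (EFin \o f) mB).1.
exact: (integrableS measurableT).
Qed.

End integrals.

Section stopped_integrals.
Context (d : measure_display) (T : measurableType d) (R : realType).
Variables (P : probability T R) (N : nat).
Variable Y : time N -> T -> R.
Hypothesis iY : forall t, P.-integrable setT (EFin \o Y t).

(** For each outcome exactly one term survives; integrals of stopped processes thus become finite
    sums of integrals at fixed times. *)
Lemma stopped_sumE (tau : T -> time N) :
  stopped Y tau = fun w => \sum_t (Y t \_ [set w | tau w = t]) w.
Proof.
apply/funext => w; rewrite (bigD1 (tau w))//= big1 ?addr0.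
  by rewrite patchE mem_set.
by move=> t tw; rewrite patchE memNset// => /= e; rewrite e eqxx in tw.
Qed.

Lemma integrable_stopped (tau : T -> time N) :
  (forall t, measurable [set w | tau w = t]) ->
  P.-integrable setT (EFin \o stopped Y tau).
Proof.
move=> mtau; rewrite stopped_sumE; apply: integrable_fin_sum => t.
exact: integrable_restrict.
Qed.

Lemma Rintegral_stopped (tau : T -> time N) (A : set T) : measurable A ->
  (forall t, measurable [set w | tau w = t]) ->
  (\int[P]_(w in A) stopped Y tau w =
   \sum_t \int[P]_(w in A `&` [set w | tau w = t]) Y t w)%R.
Proof.
move=> mA mtau; rewrite stopped_sumE Rintegral_fin_sum//; last first.
  by move=> t; exact: integrable_restrict.
by apply: eq_bigr => t _; rewrite Rintegral_mkcondr.
Qed.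

Lemma stoppedB (sigma tau : T -> time N) (w : T) :
  (sigma w <= tau w)%N ->
  stopped Y tau w - stopped Y sigma w =
  \sum_(n < N.+1) ((fun w => Y (next_date n) w - Y (of_date n) w) \_
    [set w | (sigma w <= of_date n < tau w)%N]) w.
Proof.
move=> st; pose y k := Y (inord k) w.
have yE (t : time N) : Y t w = y t by rewrite /y inord_val.
(* The path is read as a sequence indexed by the natural numbers, to which telescoping applies. *)
rewrite /stopped !yE -(telescope_sumr _ st).
(* The random range of summation becomes a filter on all dates, so that the index set no longer
   depends on [w] and the sum can be integrated term by term. *)
have -> : (\sum_(sigma w <= i < tau w) (y i.+1 - y i) =
  \sum_(0 <= i < N.+1 | (sigma w <= i < tau w)%N) (y i.+1 - y i)).
  rewrite (big_nat_widen _ _ N.+1)/=; last exact: le_cemetery.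
  rewrite (big_nat_widenl _ 0)//; apply: eq_bigl => i.
  by rewrite andbC.
rewrite big_mkord big_mkcond; apply: eq_bigr => n _; rewrite patchE of_dateE.
case: ifPn => h; first by rewrite mem_set //= !yE of_dateE.
by rewrite memNset //=; exact/negP.
Qed.

Lemma Rintegral_stoppedB (sigma tau : T -> time N) (A : set T) : measurable A ->
  (forall t, measurable [set w | sigma w = t]) ->
  (forall t, measurable [set w | tau w = t]) ->
  (forall n : 'I_N.+1, measurable [set w | (sigma w <= of_date n < tau w)%N]) ->
  (forall w, (sigma w <= tau w)%N) ->
  (\int[P]_(w in A) stopped Y tau w - \int[P]_(w in A) stopped Y sigma w =
  \sum_(n < N.+1)
    (\int[P]_(w in A `&` [set w | (sigma w <= of_date n < tau w)%N])
      Y (next_date n) w -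
     \int[P]_(w in A `&` [set w | (sigma w <= of_date n < tau w)%N])
      Y (of_date n) w))%R.
Proof.
move=> mA msigma mtau mst st.
have iS (f : T -> R) : P.-integrable setT (EFin \o f) ->
    forall B, measurable B -> P.-integrable B (EFin \o f).
  by move=> fi B mB; exact: (integrableS measurableT).
rewrite -RintegralB//; [|by apply: iS => //; exact: integrable_stopped..].
under eq_Rintegral do rewrite stoppedB//.
rewrite Rintegral_fin_sum//; last first.
  move=> n; apply: integrable_restrict => //.
  exact: (integrableB measurableT (iY (next_date n)) (iY (of_date n))).
apply: eq_bigr => n _; rewrite -Rintegral_mkcondr RintegralB//.
- exact: measurableI.
- by apply: iS => //; exact: measurableI.
- by apply: iS => //; exact: measurableI.
Qed.

End stopped_integrals.

(** * Integrability and adaptedness of the nested processes *)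

Section integrability.
Context (d : measure_display) (T : measurableType d) (R : realType).
Variable mu : {measure set T -> \bar R}.

Lemma integrable_maxr (f g : T -> R) :
  mu.-integrable setT (EFin \o f) -> mu.-integrable setT (EFin \o g) ->
  mu.-integrable setT (EFin \o (fun w => Num.max (f w) (g w))).
Proof.
move=> fi gi.
have mf : measurable_fun setT f by apply/measurable_EFinP; exact: measurable_int fi.
have mg : measurable_fun setT g by apply/measurable_EFinP; exact: measurable_int gi.
(* The maximum is dominated in absolute value by |f| + |g|. *)
apply: (@le_integrable _ _ _ _ _ measurableT _
    (fun w => `|(f w)%:E| + `|(g w)%:E|)%E).
- by apply/measurable_EFinP; exact: measurable_maxr.
- move=> w _ /=; rewrite lee_fin; apply: (le_trans _ (ler_norm _)).
  by case: (leP (f w) (g w)) => _; rewrite ?lerDl ?lerDr.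
- apply: integrableD => //; exact: integrable_abse.
Qed.

End integrability.

Section adapted_integrable.
Context (d : measure_display) (T : measurableType d) (R : realType).
Variables (P : probability T R) (N : nat) (F : 'I_N.+1 -> set (set T)).
Hypothesis hF : is_filtration F.

Let sF n : sigma_algebra setT (F n). Proof. by have [] := hF. Qed.
Let mF n : F n `<=` measurable. Proof. by have [] := hF. Qed.

Definition integrable_process (Y : 'I_N.+1 -> T -> R) :=
  forall n, P.-integrable setT (EFin \o Y n).

(** Each |X_n| is bounded by the maximum. The moment hypothesis enters the later proofs only in this
    datewise form. *)
Lemma integrable_of_max (X : 'I_N.+1 -> T -> R) : adapted F X ->
  ('E_P[fun w => (\big[Num.max/0]_(n < N.+1) `|X n w|)%R] < +oo)%E ->
  integrable_process X.
Proof.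
move=> hX hint n.
have mX p : measurable_fun setT (X p) by exact: (sub_measurable_fun (sF p) (@mF p) (hX p)).
apply/integrableP; split; first exact/measurable_EFinP.
apply: le_lt_trans hint; rewrite unlock; apply: ge0_le_integral => //=.
- by apply/measurable_EFinP; exact: measurableT_comp.
- apply/measurable_EFinP; elim: (index_enum _) => [|p s IH].
    by under eq_fun do rewrite big_nil; exact: measurable_cst.
  under eq_fun do rewrite big_cons.
  by apply: measurable_maxr => //; exact: measurableT_comp.
- move=> w _; rewrite lee_fin.
  exact: (le_bigmax 0 (fun p : 'I_N.+1 => `|X p w|) n).
Qed.

Lemma integrable_snell_steps (Y : 'I_N.+1 -> T -> R) (k : nat) :
  integrable_process Y -> P.-integrable setT (EFin \o snell_steps P F Y k).
Proof.
move=> iY; elim: k => [|k IH] /=.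
  exact: finite_measure_integrable_cst.
apply: integrable_maxr => //.
by have [] := condexpP (sF (inord (N - k))) (@mF _) IH.
Qed.

Lemma integrable_snell (Y : 'I_N.+1 -> T -> R) (t : time N) :
  integrable_process Y -> P.-integrable setT (EFin \o snell P F Y t).
Proof. exact: integrable_snell_steps. Qed.

(** No backward induction occurs here: a version of a conditional expectation given [F n] is
    measurable for [F n] as soon as its argument is integrable. *)
Lemma adapted_snell (Y : 'I_N.+1 -> T -> R) (t : time N) :
  integrable_process Y -> adapted F Y ->
  measurable_fun setT (snell P F Y t : g_sigma_algebraType (sigma_at F t) -> R).
Proof.
move=> iY hY; case: (timeP t) => [n|]; last first.
  by rewrite snell_cemetery; exact: measurable_cst.
rewrite /sigma_at extend_time_date.
rewrite (_ : snell _ _ _ _ = fun w =>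
    Num.max (Y n w) (condexp P (F n) (snell P F Y (next_date n)) w)); last first.
  by apply/funext => w; rewrite snellE.
apply: measurable_maxr; first exact: hY.
by have [] := condexpP (sF n) (@mF n) (integrable_snell (next_date n) iY).
Qed.

Lemma integrable_nested_reward (X : 'I_N.+1 -> T -> R) (V : time N -> T -> R) :
  integrable_process X -> (forall t, P.-integrable setT (EFin \o V t)) ->
  integrable_process (nested_reward P F X V).
Proof.
move=> iX iV n.
have [_ iC _] := condexpP (sF n) (@mF n) (iV (next_date n)).
exact: (integrableD measurableT (iX n) iC).
Qed.

Lemma adapted_nested_reward (X : 'I_N.+1 -> T -> R) (V : time N -> T -> R) :
  adapted F X -> (forall t, P.-integrable setT (EFin \o V t)) ->
  adapted F (nested_reward P F X V).
Proof.
move=> hX iV n; apply: measurable_funD; first exact: hX.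
by have [] := condexpP (sF n) (@mF n) (iV (next_date n)).
Qed.

Lemma integrable_V (X : 'I_N.+1 -> T -> R) (i : nat) (t : time N) :
  integrable_process X -> P.-integrable setT (EFin \o V_ P F X i t).
Proof.
move=> iX; elim: i t => [|i IH] t /=; first exact: finite_measure_integrable_cst.
by apply: integrable_snell; exact: integrable_nested_reward.
Qed.

Lemma adapted_V (X : 'I_N.+1 -> T -> R) (i : nat) (t : time N) :
  integrable_process X -> adapted F X ->
  measurable_fun setT (V_ P F X i t : g_sigma_algebraType (sigma_at F t) -> R).
Proof.
move=> iX hX; case: i => [|i] /=; first exact: measurable_cst.
apply: adapted_snell.
  by apply: integrable_nested_reward => // s; exact: integrable_V.
by apply: adapted_nested_reward => // s; exact: integrable_V.
Qed.

Lemma V_cemetery (X : 'I_N.+1 -> T -> R) (i : nat) :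
  V_ P F X i cemetery = cst 0.
Proof. by case: i => [//|i]; exact: snell_cemetery. Qed.

Lemma integrable_process_at (Y : 'I_N.+1 -> T -> R) (t : time N) :
  integrable_process Y -> P.-integrable setT (EFin \o process_at Y t).
Proof.
rewrite /process_at; case: (timeP t) => [n|] iY.
  by rewrite extend_time_date.
by rewrite extend_time_cemetery; exact: finite_measure_integrable_cst.
Qed.

End adapted_integrable.

(** * First contact times *)

Section first_contact.
Context (d : measure_display) (T : measurableType d) (R : realType) (N : nat).
Variables (V : time N -> T -> R) (Y : 'I_N.+1 -> T -> R).
Implicit Types (s : time N) (n : 'I_N.+1) (w : T).

Lemma first_contact_ge s w : (s <= first_contact V Y s w)%N.
Proof.
(* The order of the ordinals is convertible to that of their values; the lemmas on iterated minima
   speak of the former. *)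
change (s <= first_contact V Y s w)%O.
apply: le_bigmin => [|n /andP[sn _]]; last exact: sn.
exact: le_cemetery.
Qed.

Lemma first_contact_leP s w n : (first_contact V Y s w <= of_date n)%N <->
  exists k : 'I_N.+1,
    [/\ (k <= n)%N, (s <= of_date k)%N & V (of_date k) w = Y k w].
Proof.
change (first_contact V Y s w <= of_date n)%N
  with (first_contact V Y s w <= of_date n)%O.
split.
(* The default value [cemetery] lies after every date, so a minimum bounded by a date comes from an
   actual contact. *)
- move=> /bigmin_leP[cn|[k /andP[sk /eqP VY] kn]].
    have : (@cemetery N <= of_date n)%N by exact: cn.
    by rewrite leqNgt of_date_lt_cemetery.
  exists k; split => //.
  have : (of_date k <= of_date n)%N by exact: kn.
  by rewrite !of_dateE.
- move=> [k [kn sk VY]]; apply: (bigmin_inf k); first by rewrite sk VY eqxx.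
  have : (of_date k <= of_date n)%N by rewrite !of_dateE.
  exact.
Qed.

Lemma first_contact_date s w n :
  first_contact V Y s w = of_date n -> V (of_date n) w = Y n w.
Proof.
move=> e; have /first_contact_leP[k [kn sk VY]] :
  (first_contact V Y s w <= of_date n)%N by rewrite e.
(* The contact at k <= n bounds the minimum n from above, whence k = n: the minimum is attained. *)
have : (first_contact V Y s w <= of_date k)%N by apply/first_contact_leP; exists k.
rewrite e !of_dateE => nk; suff -> : n = k by [].
by apply/val_inj/eqP; rewrite eqn_leq nk.
Qed.

Lemma first_contact_lt s w n : (s <= of_date n < first_contact V Y s w)%N ->
  V (of_date n) w <> Y n w.
Proof.
move=> /andP[sn + VY]; rewrite ltnNge => /negP; apply.
by apply/first_contact_leP; exists n.
Qed.

End first_contact.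

Section first_contact_stopping.
Context (d : measure_display) (T : measurableType d) (R : realType).
Variables (N : nat) (F : 'I_N.+1 -> set (set T)).
Hypothesis hF : is_filtration F.

(** Contact by date n means contact at some k <= n with s <= k, which is known at date k by
    adaptedness. *)
Lemma stopping_time_first_contact (V : time N -> T -> R) (Y : 'I_N.+1 -> T -> R)
    (s : T -> time N) :
  (forall t, measurable_fun setT (V t : g_sigma_algebraType (sigma_at F t) -> R)) ->
  adapted F Y -> stopping_time F s ->
  stopping_time F (fun w => first_contact V Y (s w) w).
Proof.
move=> mV hY ss t; have sG := sigma_at_sigma_algebra hF t.
case: (timeP t) sG => [n|] sG; last first.
  rewrite (_ : [set w | _] = setT); first exact: sub_sigma_algebraT.
  by apply/seteqP; split => // w _ /=; exact: le_cemetery.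
rewrite (_ : [set w | _] = \bigcup_(k in [set k : 'I_N.+1 | (k <= n)%N])
    ([set w | (s w <= of_date k)%N] `&` [set w | V (of_date k) w = Y k w])).
  apply: sub_sigma_algebra_fin_bigcup => //= k kn.
  apply: (@sigma_at_le _ _ _ _ hF (of_date k)); first by rewrite !of_dateE.
  have sk := sigma_at_sigma_algebra hF (of_date k).
  apply: sub_sigma_algebraI => //.
  have := mV (of_date k); rewrite /sigma_at extend_time_date => mVk.
  have sFk : sigma_algebra setT (F k) by have [] := hF.
  rewrite sub_sigma_algebraE//.
  have := measurable_fun_eqr mVk (hY k) measurableT (_ : measurable [set true]).
  move=> /(_ I); rewrite setTI; congr measurable.
  by apply/seteqP; split=> w /= /eqP.
apply/seteqP; split=> w /=.
  by move/first_contact_leP => [k [kn sk VY]]; exists k.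
by move=> [k /= kn [sk VY]]; apply/first_contact_leP; exists k.
Qed.

End first_contact_stopping.

(** * Optional stopping for the Snell envelope *)

Section optional_stopping.
Context (d : measure_display) (T : measurableType d) (R : realType).
Variables (P : probability T R) (N : nat) (F : 'I_N.+1 -> set (set T)).
Hypothesis hF : is_filtration F.

Let sF n : sigma_algebra setT (F n). Proof. by have [] := hF. Qed.
Let mF n : F n `<=` measurable. Proof. by have [] := hF. Qed.

Lemma stopping_time_measurable (tau : T -> time N) (t : time N) :
  stopping_time F tau -> measurable [set w | tau w = t].
Proof.
by move=> /(stopping_time_eq hF) => /(_ t); exact: sigma_at_measurable.
Qed.

(** Whether [sigma] has occurred and [tau] has not is known at date n; this allows conditioning the
    increment from n to n + 1 on [F n]. *)
Lemma stopped_sigma_between (sigma tau : T -> time N) (A : set T) (n : 'I_N.+1) :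
  stopping_time F tau -> stopped_sigma F sigma A ->
  F n (A `&` [set w | (sigma w <= of_date n < tau w)%N]).
Proof.
move=> stau sA.
have := sA (of_date n); have := stau (of_date n).
rewrite /sigma_at extend_time_date => Ftau FA.
have -> : A `&` [set w | (sigma w <= of_date n < tau w)%N] =
    (A `&` [set w | (sigma w <= of_date n)%N]) `\`
    [set w | (tau w <= of_date n)%N].
  apply/seteqP; split=> w /=.
    by move=> [Aw /andP[-> nt]]; split => //; apply/negP; rewrite -ltnNge.
  by move=> [[Aw ->] /negP]; rewrite -ltnNge.
exact: sub_sigma_algebraD.
Qed.

Section snell_envelope.
Variable Y : 'I_N.+1 -> T -> R.
Hypothesis iY : integrable_process P Y.

Let U := snell P F Y.
Let iU t : P.-integrable setT (EFin \o U t).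
Proof. exact: integrable_snell. Qed.

Variables (sigma tau : T -> time N) (A : set T).
Hypotheses (ssigma : stopping_time F sigma) (stau : stopping_time F tau).
Hypotheses (st : forall w, (sigma w <= tau w)%N) (sA : stopped_sigma F sigma A).

Let mA : measurable A. Proof. exact: (stopped_sigma_measurable hF sA). Qed.

(** In each telescoping term the integral runs over an event of [F n], so U_(n+1) may be replaced by
    its conditional expectation. *)
Let U_stoppedB :
  (\int[P]_(w in A) stopped U tau w - \int[P]_(w in A) stopped U sigma w =
  \sum_(n < N.+1)
    (\int[P]_(w in A `&` [set w | (sigma w <= of_date n < tau w)%N])
      condexp P (F n) (U (next_date n)) w -
     \int[P]_(w in A `&` [set w | (sigma w <= of_date n < tau w)%N])
      U (of_date n) w))%R.
Proof.
rewrite Rintegral_stoppedB//; [|by move=> t; exact: stopping_time_measurable..|].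
  apply: eq_bigr => n _; congr (_ - _).
  by rewrite (Rintegral_condexp (sF n) (@mF n))//; exact: stopped_sigma_between.
(* The remaining measurability condition is the case of the sure event. *)
move=> n; have sT : stopped_sigma F sigma setT by exact/stopping_timeT.
have := @mF n _ (stopped_sigma_between n stau sT).
by rewrite setTI.
Qed.

Lemma le_Rintegral_snell :
  (\int[P]_(w in A) stopped (process_at Y) tau w <=
   \int[P]_(w in A) stopped U sigma w)%R.
Proof.
have mtau t := stopping_time_measurable t stau.
have iP t := integrable_process_at t iY.
(* First Y_tau <= U_tau, both sides being 0 at the cemetery; then the supermartingale property of U,
   one increment at a time. *)
apply: (@le_trans _ _ (\int[P]_(w in A) stopped U tau w)%R).
  apply: le_Rintegral => //.
  - apply: (integrableS measurableT) => //; exact: integrable_stopped.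
  - apply: (integrableS measurableT) => //; exact: integrable_stopped.
  move=> w _; rewrite /stopped /process_at /U.
  case: (timeP (tau w)) => [n|].
    by rewrite extend_time_date snellE le_max lexx.
  by rewrite extend_time_cemetery snell_cemetery.
rewrite -subr_le0 U_stoppedB; apply: sumr_le0 => n _; rewrite subr_le0.
have FB := stopped_sigma_between n stau sA.
have mB := mF FB.
have [_ iC _] := condexpP (sF n) (@mF n) (iU (next_date n)).
apply: le_Rintegral => //.
- exact: (integrableS measurableT).
- exact: (integrableS measurableT).
- by move=> w _; rewrite [leRHS]snellE le_max lexx orbT.
Qed.

Lemma eq_Rintegral_snell :
  (forall w, tau w = first_contact U Y (sigma w) w) ->
  (\int[P]_(w in A) stopped (process_at Y) tau w =
   \int[P]_(w in A) stopped U sigma w)%R.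
Proof.
(* At a finite contact time Y and U agree, and at the cemetery both vanish. *)
move=> tauE; transitivity (\int[P]_(w in A) stopped U tau w)%R.
  apply: eq_Rintegral => w _; rewrite /stopped /process_at.
  case: (timeP (tau w)) (tauE w) => [n|] e.
    by rewrite extend_time_date (first_contact_date (esym e)).
  by rewrite extend_time_cemetery /U snell_cemetery.
apply/eqP; rewrite -subr_eq0 U_stoppedB big1// => n _; apply/eqP.
rewrite subr_eq0; apply/eqP/eq_Rintegral => w /[!inE] -[_ /= nst].
(* Strictly before contact U_n differs from Y_n, so the maximum defining U_n is the conditional
   expectation and the increment contributes 0. *)
have /first_contact_lt : (sigma w <= of_date n < first_contact U Y (sigma w) w)%N.
  by rewrite -tauE.
by rewrite /U snellE; case: leP.
Qed.

End snell_envelope.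

(** On the part of [A] where tau = n, an event of [F n], the conditional expectation of V_(n+1)
    integrates like V_(n+1); at the cemetery everything vanishes, by the hypothesis on
    [V cemetery]. *)
Lemma Rintegral_nested_reward (X : 'I_N.+1 -> T -> R) (V : time N -> T -> R)
    (tau : T -> time N) (A : set T) :
  integrable_process P X -> (forall t, P.-integrable setT (EFin \o V t)) ->
  V cemetery = cst 0 -> stopping_time F tau -> stopped_sigma F tau A ->
  (\int[P]_(w in A) stopped (process_at (nested_reward P F X V)) tau w =
   \int[P]_(w in A) stopped (process_at X) tau w +
   \int[P]_(w in A) stopped V (fun w => succ_time (tau w)) w)%R.
Proof.
move=> iX iV V0 stau sA.
have mA := stopped_sigma_measurable hF sA.
have mtau t := stopping_time_measurable t stau.
have iNR := integrable_nested_reward hF iX iV.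
(* Seen as a shifted process stopped at [tau], the last term splits along the same level sets as the
   other two. *)
rewrite -[stopped V _]/(stopped (fun t => V (succ_time t)) tau).
rewrite !Rintegral_stopped//; [|by move=> t; exact: integrable_process_at..].
rewrite -big_split/=; apply: eq_bigr => t _.
rewrite /process_at; case: (timeP t) => [n|]; last first.
  rewrite !extend_time_cemetery succ_time_cemetery V0.
  by rewrite !Rintegral_cst ?mul0r ?addr0//; exact: measurableI.
rewrite !extend_time_date succ_time_date.
have FB : F n (A `&` [set w | tau w = of_date n]).
  by have := stopped_sigma_eq hF (of_date n) sA; rewrite /sigma_at extend_time_date.
have mB := mF FB.
have [_ iC _] := condexpP (sF n) (@mF n) (iV (next_date n)).
rewrite RintegralD//; [|exact: (integrableS measurableT)..].
by rewrite (Rintegral_condexp (sF n) (@mF n)).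
Qed.

End optional_stopping.

(** * Admissible vectors: first component and tail *)

Section admissible_vectors.
Context (d : measure_display) (T : measurableType d).
Variables (N : nat) (F : 'I_N.+1 -> set (set T)).
Implicit Type sigma : T -> time N.

Lemma admissible_cons sigma (m : nat) (tau : 'I_m.+1 -> T -> time N) :
  stopping_time F (tau ord0) -> (forall w, (sigma w <= tau ord0 w)%N) ->
  admissible F (fun w => succ_time (tau ord0 w)) (fun j => tau (lift ord0 j)) ->
  admissible F sigma tau.
Proof.
move=> st0 s0 [h1 h2].
have ge0 j w : (tau ord0 w <= tau j w)%N.
  case: (unliftP ord0 j) => [k|] -> //.
  by apply: leq_trans (le_succ_time _) _; exact: (h1 k).2.
have ge j w : (sigma w <= tau j w)%N by exact: leq_trans (s0 w) (ge0 j w).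
split=> [j|w].
  split; last exact: ge.
  by case: (unliftP ord0 j) => [k|] ->; [exact: (h1 k).1|].
have [l [lm fin _ inc]] := h2 w.
(* If the first component is the cemetery, so are all the later ones, and no component is finite;
   otherwise it adds one to the count of the tail. *)
have [e|ne] := eqVneq (tau ord0 w) cemetery.
  exists 0; split => // j; rewrite ltn0; apply/esym/negbTE; rewrite negbK.
  apply/eqP/val_inj/anti_leq; rewrite [X in X && _]le_cemetery.
  by have := ge0 j w; rewrite e.
exists l.+1; split => //.
- move=> j; case: (unliftP ord0 j) => [k|] ->; last by rewrite ne.
  by rewrite lift0 ltnS fin.
move=> j k; case: (unliftP ord0 j) => [j'|] ->;
    case: (unliftP ord0 k) => [k'|] -> //.
  by rewrite !lift0 !ltnS; exact: inc.
rewrite lift0 ltnS => _ k'l.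
(* The successor is strictly larger only away from the cemetery, which is where [ne] is needed. *)
apply: leq_trans ((h1 k').2 w); rewrite succ_timeE leq_min leqnn /=.
have := le_cemetery (tau ord0 w); rewrite leq_eqVlt => /orP[/eqP e|//].
by move/eqP: ne; case; exact: val_inj.
Qed.

Lemma admissible_tail sigma (m : nat) (tau : 'I_m.+1 -> T -> time N) :
  admissible F sigma tau ->
  admissible F (fun w => succ_time (tau ord0 w)) (fun j => tau (lift ord0 j)).
Proof.
move=> [h1 h2].
have ge (j : 'I_m) w : (succ_time (tau ord0 w) <= tau (lift ord0 j) w)%N.
  have [l [lm fin _ inc]] := h2 w.
  (* A finite later component is strictly larger than the first one; otherwise it is the cemetery,
     which bounds every successor. *)
  rewrite succ_timeE; have := fin (lift ord0 j); case: ltnP => [jl _|_ /esym/negbFE/eqP ->].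
    by rewrite geq_min (inc ord0 (lift ord0 j)).
  by rewrite geq_min leqnn orbT.
split=> [j|w].
  by split => //; exact: (h1 _).1.
have [l [lm fin _ inc]] := h2 w.
(* The truncated predecessor also covers l = 0, where the tail has no finite component either. *)
exists l.-1; split => //.
- by case: l lm {fin inc}.
- move=> j; rewrite -fin lift0.
  by case: l {lm fin inc}.
- move=> j k jk kl; apply: inc; rewrite ?lift0 ?ltnS//.
  by case: l kl {lm fin}.
Qed.

End admissible_vectors.

(** * Induction on the number of exercises *)

Section multiple_stopping.
Context (d : measure_display) (T : measurableType d) (R : realType).
Variables (P : probability T R) (N : nat) (F : 'I_N.+1 -> set (set T)).
Variable X : 'I_N.+1 -> T -> R.
Hypotheses (hF : is_filtration F) (hX : adapted F X).
Hypothesis iX : integrable_process P X.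
Implicit Type sigma : T -> time N.

Let iV i t : P.-integrable setT (EFin \o V_ P F X i t).
Proof. exact: integrable_V. Qed.

Lemma total_reward_recl (m : nat) (tau : 'I_m.+1 -> T -> time N) :
  total_reward X tau = fun w => stopped (process_at X) (tau ord0) w +
    total_reward X (fun j => tau (lift ord0 j)) w.
Proof. by apply/funext => w; rewrite /total_reward big_ord_recl. Qed.

Lemma integrable_total_reward (m : nat) (tau : 'I_m -> T -> time N) :
  (forall j, stopping_time F (tau j)) ->
  P.-integrable setT (EFin \o total_reward X tau).
Proof.
move=> stau; apply: integrable_fin_sum => j; apply: integrable_stopped => t.
  exact: integrable_process_at.
exact: (stopping_time_measurable hF).
Qed.

Lemma Rintegral_total_reward_recl (m : nat) (tau : 'I_m.+1 -> T -> time N)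
    (A : set T) : measurable A -> (forall j, stopping_time F (tau j)) ->
  (\int[P]_(w in A) total_reward X tau w =
   \int[P]_(w in A) stopped (process_at X) (tau ord0) w +
   \int[P]_(w in A) total_reward X (fun j => tau (lift ord0 j)) w)%R.
Proof.
move=> mA stau; rewrite total_reward_recl RintegralD//.
- apply: (integrableS measurableT) => //; apply: integrable_stopped => t.
    exact: integrable_process_at.
  exact: (stopping_time_measurable hF).
- apply: (integrableS measurableT) => //; apply: integrable_total_reward => j.
  exact: stau.
Qed.

Lemma Rintegral_total_reward0 (sigma : T -> time N) (tau : 'I_0 -> T -> time N)
    (A : set T) :
  (\int[P]_(w in A) total_reward X tau w =
   \int[P]_(w in A) stopped (V_ P F X 0) sigma w)%R.
Proof. by apply: eq_Rintegral => w _; rewrite /total_reward big_ord0. Qed.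

Lemma le_Rintegral_V (m : nat) sigma (tau : 'I_m -> T -> time N) (A : set T) :
  stopping_time F sigma -> admissible F sigma tau -> stopped_sigma F sigma A ->
  (\int[P]_(w in A) total_reward X tau w <=
   \int[P]_(w in A) stopped (V_ P F X m) sigma w)%R.
Proof.
elim: m sigma tau => [|m IH] sigma tau ssigma atau sA.
  by rewrite (Rintegral_total_reward0 sigma).
have [stau _] := atau.
have s0 := (stau ord0).1.
have st0 : forall w, (sigma w <= tau ord0 w)%N := (stau ord0).2.
have s0A : stopped_sigma F (tau ord0) A by exact: (stopped_sigma_mono hF s0 st0).
have s1 := stopping_time_succ hF s0.
have s1A : stopped_sigma F (fun w => succ_time (tau ord0 w)) A.
  by apply: (stopped_sigma_mono hF s1 _ s0A) => w; exact: le_succ_time.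
rewrite Rintegral_total_reward_recl; last 2 first.
- exact: (stopped_sigma_measurable hF sA).
- by move=> j; exact: (stau j).1.
have iNR := integrable_nested_reward hF iX (iV m).
(* V^[m+1] at [sigma] dominates X^[m+1] at the first component; the latter splits into the immediate
   reward and V^[m] one step later, which dominates the tail by induction. *)
apply: le_trans (le_Rintegral_snell hF iNR ssigma s0 st0 sA).
rewrite Rintegral_nested_reward//; [|exact: V_cemetery].
rewrite lerD2l; apply: IH => //; exact: admissible_tail atau.
Qed.

(** Since m.+1 - j.+1 = m - j, the components after the first follow the recursion for m exercises,
    started one step after the first. *)
Lemma opt_time_tail (m : nat) sigma (j : nat) (w : T) :
  opt_time P F X m.+1 sigma j.+1 w =
  opt_time P F X m (fun w => succ_time (opt_time P F X m.+1 sigma 0 w)) j w.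
Proof.
elim: j => [|j IH]; first by rewrite /= subSS.
by rewrite [RHS]/= -IH.
Qed.

Lemma opt_times_tail (m : nat) sigma :
  (fun j => opt_times P F X m.+1 sigma (lift ord0 j)) =
  opt_times P F X m (fun w => succ_time (opt_time P F X m.+1 sigma 0 w)).
Proof. by apply/funext => j; apply/funext => w; exact: opt_time_tail. Qed.

Lemma stopping_time_opt_time0 (m : nat) sigma : stopping_time F sigma ->
  stopping_time F (opt_time P F X m.+1 sigma 0).
Proof.
move=> ssigma; apply: stopping_time_first_contact => // [t|].
  exact: adapted_V.
by apply: adapted_nested_reward => // t; exact: iV.
Qed.

Lemma admissible_opt_times (m : nat) sigma : stopping_time F sigma ->
  admissible F sigma (opt_times P F X m sigma).
Proof.
elim: m sigma => [|m IH] sigma ssigma.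
  by split=> [[]//|w]; exists 0; split => // -[].
have s0 := stopping_time_opt_time0 m ssigma.
apply: admissible_cons => // [w|]; first exact: first_contact_ge.
rewrite opt_times_tail; apply: IH; exact: (stopping_time_succ hF s0).
Qed.

Lemma Rintegral_opt_times (m : nat) sigma (A : set T) :
  stopping_time F sigma -> stopped_sigma F sigma A ->
  (\int[P]_(w in A) total_reward X (opt_times P F X m sigma) w =
   \int[P]_(w in A) stopped (V_ P F X m) sigma w)%R.
Proof.
elim: m sigma => [|m IH] sigma ssigma sA.
  by rewrite (Rintegral_total_reward0 sigma).
have [stau _] := admissible_opt_times m.+1 ssigma.
have s0 := stopping_time_opt_time0 m ssigma.
have st0 : forall w, (sigma w <= opt_time P F X m.+1 sigma 0 w)%N.
  by move=> w; exact: first_contact_ge.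
have s0A := stopped_sigma_mono hF s0 st0 sA.
have s1 := stopping_time_succ hF s0.
have s1A : stopped_sigma F
    (fun w => succ_time (opt_time P F X m.+1 sigma 0 w)) A.
  by apply: (stopped_sigma_mono hF s1 _ s0A) => w; exact: le_succ_time.
rewrite Rintegral_total_reward_recl; last 2 first.
- exact: (stopped_sigma_measurable hF sA).
- by move=> j; exact: (stau j).1.
rewrite opt_times_tail IH//.
have iNR := integrable_nested_reward hF iX (iV m).
(* The first component is by computation the first contact of V^[m+1] with X^[m+1] after [sigma], so
   the upper bound for one exercise becomes an equality. *)
have := eq_Rintegral_snell hF iNR ssigma s0 st0 sA (fun w => erefl).
move=> <-; rewrite Rintegral_nested_reward//; exact: V_cemetery.
Qed.

End multiple_stopping.

(** * From integrals over the past of [sigma] to almost sure statements *)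

Theorem theorem2p5 (d : measure_display) (T : measurableType d) (R : realType)
  (P : probability T R) (N : nat) (F : 'I_N.+1 -> set (set T))
  (hF : is_filtration F) (X : 'I_N.+1 -> T -> R) (hX : adapted F X)
  (hint : ('E_P[fun w => (\big[Num.max/0]_(n < N.+1) `|X n w|)%R] < +oo)%E)
  (m : nat) (hm : (1 <= m)%N)
  (sigma : T -> time N) (hsigma : stopping_time F sigma) :
  let V_sigma := stopped (V_ P F X m) sigma in
  let tau_star := opt_times P F X m sigma in
  [/\ is_family_ess_sup P
        [set EFin \o condexp P (stopped_sigma F sigma) (total_reward X tau)
           | tau in [set tau : 'I_m -> T -> time N | admissible F sigma tau]]
        (EFin \o V_sigma),
      admissible F sigma tau_star
    & {ae P, forall w, V_sigma w =
        condexp P (stopped_sigma F sigma) (total_reward X tau_star) w}].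
Proof.
move=> V_sigma tau_star.
have iX := integrable_of_max hF hX hint.
pose G := stopped_sigma F sigma.
have sG : sigma_algebra setT G := stopped_sigma_sigma_algebra hF hsigma.
have subG : G `<=` measurable := @stopped_sigma_measurable _ _ _ _ hF sigma.
have mV : measurable_fun setT (V_sigma : g_sigma_algebraType G -> R).
  by apply: measurable_stopped => // t; exact: adapted_V.
have iV : P.-integrable setT (EFin \o V_sigma).
  apply: integrable_stopped => t; first exact: integrable_V.
  exact: (stopping_time_measurable hF).
(* The version of the conditional expectation is arbitrary; only its measurability, its
   integrability and its integrals over [G] are used. *)
have ctau (tau : 'I_m -> T -> time N) : admissible F sigma tau ->
    is_condexp P G (total_reward X tau) (condexp P G (total_reward X tau)) /\
    forall A, G A -> (\int[P]_(w in A) condexp P G (total_reward X tau) w =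
      \int[P]_(w in A) total_reward X tau w)%R.
  move=> [stau _].
  have itau := integrable_total_reward hF iX (fun j => (stau j).1).
  split; first exact: condexpP.
  by move=> A GA; exact: Rintegral_condexp.
have le_V (tau : 'I_m -> T -> time N) : admissible F sigma tau ->
    {ae P, forall w, condexp P G (total_reward X tau) w <= V_sigma w}.
  move=> atau; have [[mc ic _] Ec] := ctau _ atau.
  apply: (le_ae_of_le_Rintegral sG) => // A GA.
  by rewrite Ec//; exact: le_Rintegral_V.
have atau_star : admissible F sigma tau_star by exact: admissible_opt_times.
have V_le : {ae P, forall w, V_sigma w <= condexp P G (total_reward X tau_star) w}.
  have [[mc ic _] Ec] := ctau _ atau_star.
  apply: (le_ae_of_le_Rintegral sG) => // A GA.
  by rewrite Ec// Rintegral_opt_times.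
split => //.
- split.
  + by apply/measurable_EFinP; exact: (sub_measurable_fun sG).
  + move=> _ [tau atau <-]; apply: filterS (le_V _ atau) => w.
    by rewrite lee_fin.
  (* The supremum is attained at [tau_star]: an upper bound of the family dominates that member,
     hence [V_sigma]. *)
  + move=> Z' _ /(_ _ (ex_intro2 _ _ tau_star atau_star erefl)).
    apply: filterS2 V_le => w VZ; apply: le_trans.
    by rewrite lee_fin.
- apply: filterS2 V_le (le_V _ atau_star) => w VZ ZV.
  by apply/eqP; rewrite eq_le VZ.
Qed.
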